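(* Let $m,n\ge 2$ be integers and $F\subseteq E(K_{m,n})$. Then $S_F$ is a mutual-visibility set of maximum cardinality of $L(K_{m,n})$ if and only if $F$ is a set of edges of maximum cardinality among all $F'\subseteq E(K_{m,n})$ such that $(K_{m,n})_{F'}$ contains no $4$-cycle.
   Context: $L(G)$ denotes the line graph of $G$, with vertex set $\{e_{uv}: uv\in E(G)\}$, $e_{uv}$ and $e_{u'v'}$ adjacent iff the edges share an endpoint. For $F\subseteq E(G)$, $S_F=\{e_{uv}:uv\in F\}$, and $G_F$ is the subgraph of $G$ with edge set $F$ and vertex set the endpoints of edges of $F$. For a connected graph $H$ and $X\subseteq V(H)$, two vertices are $X$-visible if there is a shortest path between them whose internal vertices are not in $X$; $X$ is a mutual-visibility set if every two vertices of $X$ are $X$-visible. *)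

(* Defs.v *)
From mathcomp Require Import all_boot.

Set Implicit Arguments.
Unset Strict Implicit.
Unset Printing Implicit Defensive.

Record sgraph := SGraph {
  vertex :> finType;
  adj : rel vertex;
  adj_sym : symmetric adj;
  adj_irrefl : irreflexive adj
}.

Definition edges (G : sgraph) : {set {set G}} :=
  [set e | [exists u, exists v, adj u v && (e == [set u; v])]].

Section LineGraph.
Variable G : sgraph.

Definition line_vertex : finType := {e : {set G} | e \in edges G}.

Definition line_adj : rel line_vertex :=
  fun e f => (e != f) && (val e :&: val f != set0).

Lemma line_adj_sym : symmetric line_adj.
Proof. by move=> e f; rewrite /line_adj eq_sym setIC. Qed.

Lemma line_adj_irrefl : irreflexive line_adj.
Proof. by move=> e; rewrite /line_adj eqxx. Qed.

Definition line_graph : sgraph := SGraph line_adj_sym line_adj_irrefl.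

(* S_F *)
Definition line_set (F : {set {set G}}) : {set line_graph} :=
  [set e : line_vertex | val e \in F].

End LineGraph.

Section EdgeSubgraph.
Variables (G : sgraph) (F : {set {set G}}).

Definition esub_vertex : finType := {v : G | v \in cover F}.

Definition esub_adj : rel esub_vertex :=
  fun u v => adj (val u) (val v) && ([set val u; val v] \in F).

Lemma esub_adj_sym : symmetric esub_adj.
Proof. by move=> u v; rewrite /esub_adj adj_sym setUC. Qed.

Lemma esub_adj_irrefl : irreflexive esub_adj.
Proof. by move=> u; rewrite /esub_adj adj_irrefl. Qed.

(* G_F, for F a subset of edges G *)
Definition edge_subgraph : sgraph := SGraph esub_adj_sym esub_adj_irrefl.

End EdgeSubgraph.

(* c lists the vertices of a cycle of length k; only meaningful for 3 <= k *)
Definition has_cycle (k : nat) (G : sgraph) : Prop :=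
  exists2 c : seq G, size c = k & ucycle (@adj G) c.

Section MutualVisibility.
Variable H : sgraph.
Implicit Types (x y : H) (p : seq H) (X : {set H}).

(* The path visits x :: p in this order, so its length is size p. *)
Definition is_path x y p : Prop :=
  [/\ path (@adj H) x p, last x p = y & uniq (x :: p)].

Definition shortest_path x y p : Prop :=
  is_path x y p /\ forall q, is_path x y q -> size p <= size q.

Definition internal x p : seq H := behead (belast x p).

Definition visible X x y : Prop :=
  exists2 p, shortest_path x y p & {in internal x p, forall z, z \notin X}.

Definition mutual_visibility_set X : Prop :=
  {in X &, forall x y, visible X x y}.

End MutualVisibility.

Definition of_max_card (T : finType) (P : {set T} -> Prop) (A : {set T}) : Prop :=
  P A /\ forall B : {set T}, P B -> #|B| <= #|A|.

Section CompleteBipartite.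
Variables m n : nat.

Definition Kmn_adj : rel ('I_m + 'I_n) :=
  fun u v => match u, v with
             | inl _, inr _ | inr _, inl _ => true
             | _, _ => false
             end.

Lemma Kmn_adj_sym : symmetric Kmn_adj.
Proof. by case=> [i|i] [j|j]. Qed.

Lemma Kmn_adj_irrefl : irreflexive Kmn_adj.
Proof. by case. Qed.

Definition Kmn : sgraph := SGraph Kmn_adj_sym Kmn_adj_irrefl.

End CompleteBipartite.

(* Main.v *)
Require Import Defs.
From mathcomp Require Import all_boot.

(** L(K_{m,n}) is the rook's graph on the m x n grid. Two cells in different
    rows and columns are at distance 2, and the only common neighbours of
    (i, j) and (k, l) are the two other corners (i, l) and (k, j) of their
    rectangle. So a set of cells is a mutual-visibility set iff it does not
    contain all four corners of a rectangle, which is exactly a 4-cycle in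
    K_{m,n}. The two maximisation problems therefore have the same feasible
    sets. *)

Set Implicit Arguments.
Unset Strict Implicit.
Unset Printing Implicit Defensive.

Section LineSet.
Variable G : sgraph.

Lemma line_set_imset (X : {set line_graph G}) : line_set (val @: X) = X.
Proof. by apply/setP=> e; rewrite inE mem_imset //; apply: val_inj. Qed.

Lemma imset_sub_edges (X : {set line_graph G}) : val @: X \subset edges G.
Proof. by apply/subsetP=> _ /imsetP[e _ ->]; apply: valP. Qed.

(** [line_set] discards the members of [F] that are not edges, so [F] is recovered only inside
    [edges G]. *)
Lemma imset_line_set (F : {set {set G}}) :
  F \subset edges G -> val @: line_set F = F.
Proof.
move=> /subsetP sF; apply/setP=> e; apply/imsetP/idP => [[f] | Fe].
  by rewrite inE => Ff ->.
by exists (Sub e (sF e Fe) : line_vertex G); rewrite ?inE SubK.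
Qed.

Lemma card_line_set (F : {set {set G}}) :
  F \subset edges G -> #|line_set F| = #|F|.
Proof.
by move=> sF; rewrite -{2}(imset_line_set sF) card_imset //; apply: val_inj.
Qed.

End LineSet.

Section Rook.
Variables m n : nat.
Implicit Types (i k : 'I_m) (j l : 'I_n).

Definition cell_set i j : {set Kmn m n} := [set inl i; inr j].

Lemma cell_set_edge i j : cell_set i j \in edges (Kmn m n).
Proof.
rewrite inE; apply/existsP; exists (inl i).
by apply/existsP; exists (inr j); rewrite /= eqxx.
Qed.

Definition cell i j : line_graph (Kmn m n) :=
  Sub (cell_set i j) (cell_set_edge i j).

Lemma mem_cell_inl i j k : ((inl k : Kmn m n) \in cell_set i j) = (k == i).
Proof. by rewrite !inE orbF. Qed.

Lemma mem_cell_inr i j l : ((inr l : Kmn m n) \in cell_set i j) = (l == j).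
Proof. by rewrite !inE. Qed.

Lemma edgesKmnP (e : {set Kmn m n}) :
  e \in edges (Kmn m n) -> exists i j, e = cell_set i j.
Proof.
rewrite inE => /existsP[[i|j] /existsP[[k|l] /andP[//= _ /eqP->]]].
  by exists i, l.
by exists k, j; rewrite setUC.
Qed.

Lemma cellP (x : line_graph (Kmn m n)) : exists i j, x = cell i j.
Proof. by have [i [j e]] := edgesKmnP (valP x); exists i, j; apply: val_inj. Qed.

Lemma cell_inj i j k l : cell i j = cell k l -> i = k /\ j = l.
Proof.
move=> /(congr1 val) /= e; split.
  by apply/eqP; rewrite -(mem_cell_inl k l) -e mem_cell_inl.
by apply/eqP; rewrite -(mem_cell_inr k l) -e mem_cell_inr.
Qed.

Lemma line_adj_cell i j k l :
  line_adj (cell i j) (cell k l) =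
  (cell i j != cell k l) && ((i == k) || (j == l)).
Proof.
rewrite /line_adj /=; congr andb; apply/set0Pn/orP.
  by case=> -[a|b]; rewrite inE ?mem_cell_inl ?mem_cell_inr => /andP[/eqP-> ->];
    [left | right].
case=> /eqP->; [exists (inl k) | exists (inr l)];
  by rewrite inE ?mem_cell_inl ?mem_cell_inr eqxx.
Qed.

Lemma cell_neq i j k l : (i != k) || (j != l) -> cell i j != cell k l.
Proof. by apply: contraTneq => /cell_inj[-> ->]; rewrite !eqxx. Qed.

(** A shortest path here has at most one edge, hence no internal vertex that [X] could block. *)
Lemma visible_same_line (X : {set line_graph (Kmn m n)}) i j k l :
  (i == k) || (j == l) -> visible X (cell i j) (cell k l).
Proof.
move=> same; have [->|neq] := eqVneq (cell i j) (cell k l).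
  by exists [::].
exists [:: cell k l]; last by [].
split; first by split; rewrite /= ?line_adj_cell ?inE ?neq ?same.
by case=> // -[_ /= e _]; rewrite e eqxx in neq.
Qed.

Lemma path2_cell i j k l : i != k -> j != l ->
  is_path (cell i j) (cell k l) [:: cell i l; cell k l] /\
  is_path (cell i j) (cell k l) [:: cell k j; cell k l].
Proof.
move=> ik jl.
by split; split; rewrite /= ?line_adj_cell ?inE ?negb_or ?eqxx ?orbT ?andbT //;
  rewrite !cell_neq ?ik ?jl ?orbT.
Qed.

Lemma size_path_cell_ge2 i j k l p : i != k -> j != l ->
  is_path (cell i j) (cell k l) p -> 2 <= size p.
Proof.
move=> ik jl [pth lst _]; case: p pth lst => [_|z [|//]] /=.
  by case/cell_inj=> /eqP; rewrite (negbTE ik).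
by rewrite andbT => + zE; rewrite zE line_adj_cell (negbTE ik) (negbTE jl) andbF.
Qed.

(** The distance is exactly 2, so visibility depends only on the midpoint, which must be one of the
    two remaining corners. *)
Lemma visible_cell (X : {set line_graph (Kmn m n)}) i j k l :
  i != k -> j != l ->
  visible X (cell i j) (cell k l) <-> (cell i l \notin X) || (cell k j \notin X).
Proof.
move=> ik jl; have [p1 p2] := path2_cell ik jl; split.
  case=> p [pth /(_ _ p1)].
  (* Comparison with the corner path [p1] bounds the length by 2, and the shorter lengths are
     impossible. *)
  case: p pth => [|z [|y [|//]]] pth _ intX;
    do ?[by have := size_path_cell_ge2 ik jl pth].
  have zX : z \notin X by apply: intX; rewrite /internal /= inE.
  case: pth => /= /and3P[iz zy _] yE _; rewrite {}yE in zy.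
  have [a [b zE]] := cellP z; rewrite {}zE in zX iz zy.
  move: iz zy zX; rewrite !line_adj_cell => /andP[_ iz] /andP[_ zy].
  (* If [z] shared its row with both ends, or its column with both, then [i = k] or [j = l]; the two
     mixed cases are the corners. *)
  case/orP: iz zy => /eqP <- /orP[] /eqP e zX.
  - by rewrite e eqxx in ik.
  - by rewrite -e zX.
  - by rewrite -e zX orbT.
  - by rewrite e eqxx in jl.
case/orP=> notX; [exists [:: cell i l; cell k l] | exists [:: cell k j; cell k l]];
  do ?[by split=> // q; apply: size_path_cell_ge2];
  by move=> z; rewrite /internal /= inE => /eqP->.
Qed.

(** Stated for a predicate on indices, so that it applies both to vertices of the line graph and to
    edges of [Kmn m n]. *)
Definition rectangle_free (P : 'I_m -> 'I_n -> bool) : Prop :=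
  forall i k j l, i != k -> j != l -> ~ [/\ P i j, P k l, P i l & P k j].

Lemma mutual_visibility_rectangle_free (X : {set line_graph (Kmn m n)}) :
  mutual_visibility_set X <-> rectangle_free (fun i j => cell i j \in X).
Proof.
split=> [mv i k j l ik jl [Xij Xkl Xil Xkj] | rf x y].
  (* One diagonal of the rectangle supplies the two ends, the other blocks both midpoints. *)
  by have /(visible_cell _ ik jl) := mv _ _ Xij Xkl; rewrite Xil Xkj.
have [i [j ->]] := cellP x; have [k [l ->]] := cellP y => Xij Xkl.
have [|] := boolP ((i == k) || (j == l)); first exact: visible_same_line.
rewrite negb_or => /andP[ik jl]; apply/visible_cell=> //.
by rewrite -negb_and; apply/negP => /andP[Xil Xkj]; apply: (rf i k j l).
Qed.

Lemma no_cycle4_rectangle_free (F : {set {set Kmn m n}}) :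
  ~ has_cycle 4 (edge_subgraph F) <->
  rectangle_free (fun i j => cell_set i j \in F).
Proof.
split=> [nC i k j l ik jl [Fij Fkl Fil Fkj] | rf [c]].
  have cov e (v : Kmn m n) : e \in F -> v \in e -> v \in cover F.
    by move=> Fe ve; apply/bigcupP; exists e.
  have ci : inl i \in cover F by apply: (cov _ _ Fij); rewrite mem_cell_inl.
  have ck : inl k \in cover F by apply: (cov _ _ Fkl); rewrite mem_cell_inl.
  have cj : inr j \in cover F by apply: (cov _ _ Fij); rewrite mem_cell_inr.
  have cl : inr l \in cover F by apply: (cov _ _ Fkl); rewrite mem_cell_inr.
  (* The cycle i, j, k, l alternates sides, and its four edges are the corners of the rectangle. *)
  pose w v (cv : v \in cover F) : edge_subgraph F := Sub v cv.
  apply: nC; exists [:: w _ ci; w _ cj; w _ ck; w _ cl] => //.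
  rewrite /ucycle /ucycleb /= /esub_adj /= !inE /=.
  rewrite -!val_eqE /= Fij (setUC [set inr j]) Fkj Fkl (setUC [set inr l]) Fil.
  by rewrite orbF /=; apply/and3P.
case: c => [|a [|b [|c [|d [|//]]]]] //= _ /andP[/= /and5P[ab bc cd da _]].
rewrite !inE !negb_or -!val_eqE => /and3P[/and3P[_ ac _] /andP[_ bd] _].
move: ab bc cd da ac bd; rewrite /esub_adj.
(* Adjacency forces the sides to alternate, leaving two cases according to the side of [a].
   Distinctness of opposite vertices gives two distinct rows and two distinct columns. *)
case: (val a) => [i|j]; case: (val b) => [k|l] //=;
  case: (val c) => [i'|j'] //=; case: (val d) => [k'|l'] //= ab bc cd da ac bd.
  by apply: (rf i i' l l'); rewrite // /cell_set; split; rewrite // setUC.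
by apply: (rf k k' j j'); rewrite // /cell_set; split; rewrite // setUC.
Qed.

Lemma mutual_visibility_line_set (F : {set {set Kmn m n}}) :
  mutual_visibility_set (line_set F) <-> ~ has_cycle 4 (edge_subgraph F).
Proof.
have rfE : rectangle_free (fun i j => cell i j \in line_set F) <->
           rectangle_free (fun i j => cell_set i j \in F).
  by split=> rf i k j l ik jl; have := rf i k j l ik jl; rewrite !inE.
split.
  by move/mutual_visibility_rectangle_free/rfE/no_cycle4_rectangle_free.
by move/no_cycle4_rectangle_free/rfE/mutual_visibility_rectangle_free.
Qed.

End Rook.

Theorem theorem3p13 (m n : nat) (hm : 2 <= m) (hn : 2 <= n)
    (F : {set {set Kmn m n}}) (hF : F \subset edges (Kmn m n)) :
  of_max_card (@mutual_visibility_set (line_graph (Kmn m n))) (line_set F) <->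
  of_max_card (fun F' : {set {set Kmn m n}} =>
              F' \subset edges (Kmn m n) /\ ~ has_cycle 4 (edge_subgraph F')) F.
Proof.
split=> [[mvF maxF] | [[_ nC] maxF]].
  split; first by split=> //; apply/mutual_visibility_line_set.
  move=> B [sB /mutual_visibility_line_set/maxF].
  by rewrite !card_line_set.
split; first exact/mutual_visibility_line_set.
(* [B] consists of line graph vertices; the competitor for [maxF] is its set of underlying edges
   [val @: B], of the same size. *)
move=> B mvB; rewrite (card_line_set hF) -(card_imset B val_inj).
apply: maxF; split; first exact: imset_sub_edges.
by apply/mutual_visibility_line_set; rewrite line_set_imset.
Qed.
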